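(* Let $(\Omega,\mathcal F,\mu)$ be a measure space and $p\in[1,\infty)$. The following are equivalent: (i) the closed unit ball $B_{L^p(\Omega,\mathcal F,\mu)}=\{f:\|f\|_p\le1\}$ is uniformly approximable; (ii) $L^p(\Omega,\mathcal F,\mu)$ is finite dimensional; (iii) $\mu$ is atomic and has only a finite number of atoms of finite measure, up to measure $0$. Moreover, if these assertions are false, then $N_{p,\varepsilon}(B_{L^p(\Omega,\mathcal F,\mu)})=\infty$ for every $\varepsilon\in(0,1)$.
   Context: All measures are assumed not identically zero. For $k\ge1$, $\mathscr G_{p,k}$ is the set of functions $\sum_{i=1}^l a_i\mathbf 1_{A_i}$ belonging to $L^p(\Omega,\mathcal F,\mu)$ with $l\le k$, $\{A_i\}$ a measurable partition of $\Omega$, $a_i\in\mathbb R$. For $\mathscr A\subset L^p$ and $\varepsilon>0$, $N_{p,\varepsilon}(\mathscr A)=\inf\{k\ge1:\ \forall f\in\mathscr A\ \exists h\in\mathscr G_{p,k},\ \|f-h\|_p\le\varepsilon\}$ (with $\inf\emptyset=\infty$); $\mathscr A$ is uniformly approximable (UA) if $N_{p,\varepsilon}(\mathscr A)<\infty$ for all $\varepsilon>0$. An atom is a measurable $A$ with $\mu(A)>0$ such that every measurable $B\subset A$ with $\mu(B)<\mu(A)$ has $\mu(B)=0$. $\mu$ is atomic if every measurable set of positive measure contains an atom. $\mu$ has a finite number of atoms of finite measure up to measure $0$ if there is a finite (possibly empty) collection $\mathcal C$ of atoms of finite measure such that every atom $B$ either has $\mu(B)=\infty$ or satisfies $\mu(A\triangle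 B)=0$ for some $A\in\mathcal C$. *)

(* Defs.v *)
From HB Require Import structures.
From mathcomp Require Import all_boot all_order all_algebra.
From mathcomp Require Import all_classical all_reals all_analysis.
Set Implicit Arguments. Unset Strict Implicit. Unset Printing Implicit Defensive.
Import Order.TTheory GRing.Theory Num.Theory.
Local Open Scope classical_set_scope.
Local Open Scope ring_scope.

Section Defs.
Context {d : measure_display} {T : measurableType d} {R : realType}.
Variable mu : {measure set T -> \bar R}.

Definition pnorm (p : R) (f : T -> R) : \bar R := Lnorm mu p%:E (EFin \o f).

Definition inLp (p : R) (f : T -> R) : Prop :=
  measurable_fun setT f /\ (pnorm p f < +oo)%E.

Definition unit_ball (p : R) : set (T -> R) :=
  [set f | inLp p f /\ (pnorm p f <= 1)%E].

Definition G_pk (p : R) (k : nat) : set (T -> R) :=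
  [set h | inLp p h /\
    exists (l : nat) (A : 'I_l -> set T) (a : 'I_l -> R),
      (l <= k)%N /\
      (forall i, measurable (A i)) /\
      (forall i j, i != j -> A i `&` A j = set0) /\
      (\bigcup_(i in [set: 'I_l]) A i = setT) /\
      h = (fun x => \sum_(i < l) a i * \1_(A i) x)].

(* "every f in SA is eps-approximated by an element of G_{p,k}", i.e. k belongs
   to the set whose infimum is N_{p,eps}(SA) *)
Definition approx_k (p : R) (eps : R) (SA : set (T -> R)) (k : nat) : Prop :=
  (1 <= k)%N /\
  forall f, SA f -> exists h, G_pk p k h /\ (pnorm p (fun x => (f x - h x)%R) <= eps%:E)%E.

Definition N_finite (p eps : R) (SA : set (T -> R)) : Prop :=
  exists k, approx_k p eps SA k.

(* N_{p,eps}(SA) = oo  (infimum of the empty set) *)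
Definition N_infinite (p eps : R) (SA : set (T -> R)) : Prop :=
  forall k, ~ approx_k p eps SA k.

Definition UA (p : R) (SA : set (T -> R)) : Prop :=
  forall eps : R, 0 < eps -> N_finite p eps SA.

Definition Lp_finite_dim (p : R) : Prop :=
  exists (n : nat) (g : 'I_n -> T -> R),
    (forall i, inLp p (g i)) /\
    forall f, inLp p f ->
      exists c : 'I_n -> R,
        f = (fun x => \sum_(i < n) c i * g i x) %[ae mu].

Definition is_atom (A : set T) : Prop :=
  measurable A /\ (0 < mu A)%E /\
  forall B, measurable B -> B `<=` A -> (mu B < mu A)%E -> mu B = 0%E.

Definition atomic : Prop :=
  forall A, measurable A -> (0 < mu A)%E ->
    exists B, B `<=` A /\ is_atom B.

Definition symdiff (A B : set T) : set T := (A `\` B) `|` (B `\` A).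

Definition finite_atoms_finite_measure : Prop :=
  exists C : seq (set T),
    (forall A, A \in C -> is_atom A /\ (mu A < +oo)%E) /\
    forall B, is_atom B ->
      mu B = +oo%E \/ exists2 A, A \in C & mu (symdiff A B) = 0%E.

End Defs.

(* Main.v *)
(** If the finite positive values of [mu] stay in some [[a, b]] with [a > 0],
    splitting sets terminates, so [mu] is atomic, and disjoint atoms of finite
    measure are at most [b / a] many. If they do not, one can extract
    arbitrarily many disjoint sets [G_1, ..., G_n] whose measures are pairwise
    apart by any prescribed ratio; then [f = \sum_i (n mu(G_i))^(-1/p) 1_(G_i)]
    has norm 1, carries mass [1/n] on each [G_i], and its values lie so far
    apart on a logarithmic scale that each value of a competitor [h] is within
    relative distance [q < 1] of at most one of them. Hence a function with
    [k] values leaves an error [||f - h||^p >= q^p (n - k) / n]. *)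
Require Import Defs.
From HB Require Import structures.
From mathcomp Require Import all_boot all_order all_algebra.
From mathcomp Require Import all_classical all_reals all_analysis.
From mathcomp Require Import measurable_realfun lra.
Set Implicit Arguments.
Unset Strict Implicit.
Unset Printing Implicit Defensive.
Import Order.TTheory GRing.Theory Num.Theory.
Local Open Scope classical_set_scope.
Local Open Scope ring_scope.

(** * Step functions on finitely many disjoint sets *)

Definition step {T : Type} {R : realType} n (a : 'I_n -> R) (A : 'I_n -> set T)
  : T -> R := fun x => \sum_(i < n) a i * \1_(A i) x.

Definition disj {T : Type} n (A : 'I_n -> set T) :=
  forall i j, i != j -> A i `&` A j = set0.

Lemma ltr_bound_normr {R : realType} (x : R) : x < (Num.bound `|x|)%:R.
Proof. by rewrite (le_lt_trans (ler_norm x))// archi_boundP. Qed.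

Section step_functions.
Context {T : Type} {R : realType} (n : nat).
Implicit Types (a : 'I_n -> R) (A : 'I_n -> set T).

Lemma disj_eq A i j x : disj A -> A i x -> A j x -> i = j.
Proof.
move=> dA Ai Aj; apply/eqP/negP => /negP /dA A0.
by have : (A i `&` A j) x by []; rewrite A0.
Qed.

Lemma step_in a A i x : disj A -> A i x -> step a A x = a i.
Proof.
move=> dA Ai; rewrite /step (bigD1 i)//= big1 ?addr0; last first.
  move=> j ji; rewrite indicE memNset ?mulr0// => Aj.
  by rewrite (disj_eq dA Ai Aj) eqxx in ji.
by rewrite indicE mem_set// mulr1.
Qed.

Lemma step_out a A x : (forall i, ~ A i x) -> step a A x = 0.
Proof. by move=> Ax; rewrite /step big1// => i _; rewrite indicE memNset ?mulr0. Qed.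

Lemma step_normr_powR a A (p : R) x : p != 0 -> disj A ->
  `|step a A x| `^ p = step (fun i => `|a i| `^ p) A x.
Proof.
move=> p0 dA; have [[i Ai]|Ax] := pselect (exists i, A i x).
  by rewrite !(step_in _ dA Ai).
by rewrite !step_out ?normr0 ?powR0// => i Ai; apply: Ax; exists i.
Qed.

Lemma step_ge0 a A x : (forall i, 0 <= a i) -> 0 <= step a A x.
Proof. by move=> a0; apply: sumr_ge0 => i _; rewrite mulr_ge0. Qed.

End step_functions.

(** * The integral of |f|^p and its value on step functions *)

Section Lp_facts.
Context {d : measure_display} {T : measurableType d} {R : realType}.
Variable mu : {measure set T -> \bar R}.
Implicit Types (p : R) (f g : T -> R).

Definition Lp_int p f : \bar R := (\int[mu]_x (`|f x| `^ p)%:E)%E.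

Lemma measurable_step n (a : 'I_n -> R) (A : 'I_n -> set T) :
  (forall i, measurable (A i)) -> measurable_fun setT (step a A).
Proof.
move=> mA; apply: measurable_sum => i.
by apply: measurable_funM => //; exact: measurable_indic.
Qed.

Lemma measurable_normr_powR p f : measurable_fun setT f ->
  measurable_fun setT (fun x => (`|f x| `^ p)%:E).
Proof.
move=> mf; apply/measurable_EFinP.
apply: (measurableT_comp (measurable_powR p)).
exact: measurableT_comp.
Qed.

Lemma pnormE p f : pnorm mu p f = (Lp_int p f `^ p^-1)%E.
Proof.
by rewrite /pnorm unlock.
Qed.

Lemma pnorm_poweR p f : p != 0 -> (pnorm mu p f `^ p)%E = Lp_int p f.
Proof.
move=> p0; rewrite pnormE -poweRrM mulVf// poweRe1//.
by apply: integral_ge0 => x _; rewrite lee_fin powR_ge0.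
Qed.

Lemma Lp_int_lty p f : p != 0 ->
  (pnorm mu p f < +oo)%E <-> (Lp_int p f < +oo)%E.
Proof.
move=> p0; split=> h; last by rewrite pnormE poweR_lty.
by rewrite -pnorm_poweR// poweR_lty.
Qed.

Lemma pnorm_le p f (e : R) : 0 < p -> 0 <= e ->
  (pnorm mu p f <= e%:E)%E <-> (Lp_int p f <= (e `^ p)%:E)%E.
Proof.
move=> p0 e0; have pn0 : (0 <= pnorm mu p f)%E by exact: Lnorm_ge0.
have I0 : (0 <= Lp_int p f)%E.
  by apply: integral_ge0 => x _; rewrite lee_fin powR_ge0.
have homo r (x y : \bar R) : 0 <= r -> (0 <= x -> x <= y -> x `^ r <= y `^ r)%E.
  move=> r0 x0 xy; have y0 := le_trans x0 xy.
  by apply: gt0_ler_poweR => //; rewrite in_itv/=; apply/andP; split; rewrite ?leey.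
split=> h.
  by rewrite -pnorm_poweR ?gt_eqF// -poweR_EFin; apply: homo => //; exact: ltW.
rewrite pnormE.
have -> : e%:E = ((e `^ p)%:E `^ p^-1)%E.
  by rewrite poweR_EFin -powRrM mulfV ?gt_eqF// powRr1.
by apply: homo => //; rewrite invr_ge0 ltW.
Qed.

Lemma ae_eq_pnorm p f g : measurable_fun setT f -> measurable_fun setT g ->
  f = g %[ae mu] -> pnorm mu p f = pnorm mu p g.
Proof.
move=> mf mg fg; rewrite !pnormE; congr (_ `^ _)%E.
apply: ge0_ae_eq_integral => //; try exact: measurable_normr_powR.
by move: fg; apply: filterS => x fgx /fgx ->.
Qed.

Lemma integral_step n (a : 'I_n -> R) (A : 'I_n -> set T) :
  (forall i, 0 <= a i) -> (forall i, measurable (A i)) ->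
  (\int[mu]_x (step a A x)%:E = \sum_(i < n) (a i)%:E * mu (A i))%E.
Proof.
move=> a0 mA; under eq_integral do rewrite /step -sumEFin.
have mindic i : measurable_fun setT (fun x => (\1_(A i) x : R)%:E).
  exact/measurable_EFinP/measurable_indic.
rewrite ge0_integral_sum//; last 2 first.
- by move=> i; apply/measurable_EFinP/measurable_funM.
- by move=> i x _; rewrite lee_fin mulr_ge0.
apply: eq_bigr => i _; under eq_integral do rewrite EFinM.
by rewrite ge0_integralZl ?lee_fin ?integral_indic ?setIT.
Qed.

Lemma Lp_int_step p n (a : 'I_n -> R) (A : 'I_n -> set T) : p != 0 ->
  disj A -> (forall i, measurable (A i)) ->
  (Lp_int p (step a A) = \sum_(i < n) (`|a i| `^ p)%:E * mu (A i))%E.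
Proof.
move=> p0 dA mA; rewrite /Lp_int.
under eq_integral do rewrite step_normr_powR//.
by rewrite integral_step// => i; exact: powR_ge0.
Qed.

(** A zero coefficient is allowed on a set of infinite measure, so that the complement of the atoms
    can be one of the pieces. *)
Lemma inLp_step p n (a : 'I_n -> R) (A : 'I_n -> set T) : p != 0 ->
  disj A -> (forall i, measurable (A i)) ->
  (forall i, a i = 0 \/ (mu (A i) < +oo)%E) -> inLp mu p (step a A).
Proof.
move=> p0 dA mA fA; split; first exact: measurable_step.
apply/Lp_int_lty => //; rewrite Lp_int_step//.
apply: lte_sum_pinfty => i _; have [->|Ai] := fA i.
  by rewrite normr0 powR0// mul0e ltry.
by rewrite lte_mul_pinfty// ?lee_fin ?powR_ge0.
Qed.

End Lp_facts.

(** * Counting well-approximated coefficients *)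

Section combinatorics.
Context {R : realType}.

(** The intervals of radius q c_i around c_i are disjoint: if K c_i <= c_i', then (1 + q) c_i <= (1
    - q) K c_i <= (1 - q) c_i'. So no [a j] serves two indices, and picking one [j] for each
    approximated [i] is injective. *)
Lemma card_approximated n l (q K : R) (c : 'I_n -> R) (a : 'I_l -> R) :
  q < 1 -> 1 + q <= K * (1 - q) -> (forall i, 0 < c i) ->
  (forall i j, i != j -> K * c i <= c j \/ K * c j <= c i) ->
  (#|[pred i | [exists j, (`|c i - a j| < q * c i)%R]]| <= l)%N.
Proof.
move=> q1 Kq c0 cK.
pose good i : pred 'I_l := fun j => `|c i - a j| < q * c i.
have key i i' j : good i j -> good i' j -> ~ K * c i <= c i'.
  rewrite /good !ltr_norml => /andP[h1 h2] /andP[h3 h4] h.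
  have := c0 i; have : (1 - q) * (K * c i) <= (1 - q) * c i'.
    by apply: ler_wpM2l h; rewrite subr_ge0 ltW.
  have : (1 + q) * c i <= (1 - q) * (K * c i).
    by rewrite mulrA [_ * K]mulrC; apply: ler_wpM2r Kq; exact: ltW.
  by lra.
rewrite -[leqRHS]card_ord.
pose F i := [pick j | good i j].
have FS i : [exists j, good i j] -> exists2 j, good i j & F i = Some j.
  move=> /existsP[j ij]; rewrite /F; case: pickP => [j' ?|/(_ j)]; first by exists j'.
  by rewrite ij.
case: l => [|l] in a good key F FS *.
  by rewrite card_ord leqn0; apply/eqP/eq_card0 => i; apply/existsP => -[[]].
apply: (@leq_card_in _ _ (fun i => odflt ord0 (F i))) => i i'.
move=> /FS[j ij ->] /FS[j' ij' ->] /= jj'; rewrite -jj' in ij'.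
apply/eqP/negP => /negP /cK[|]; [exact: key ij ij'|exact: key ij' ij].
Qed.

End combinatorics.

(** * Disjoint sets whose measures are far apart *)

Section separated_families.
Context {d : measure_display} {T : measurableType d} {R : realType}.
Variable mu : {measure set T -> \bar R}.
Local Open Scope ereal_scope.

Definition separated (M : R) n (G : 'I_n -> set T) :=
  [/\ disj G,
      forall i, measurable (G i) /\ 0 < mu (G i) < +oo &
      forall i j, i != j ->
        M%:E * mu (G i) <= mu (G j) \/ M%:E * mu (G j) <= mu (G i)].

(** The new set sits at [ord_max]; the old ones are reached through [lift ord_max]. *)
Definition extend n (G : 'I_n -> set T) (E : set T) (i : 'I_n.+1) : set T :=
  if unlift ord_max i is Some j then G j else E.

Lemma extend_max n (G : 'I_n -> set T) E : extend G E ord_max = E.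
Proof. by rewrite /extend unlift_none. Qed.

Lemma extend_lift n (G : 'I_n -> set T) E i : extend G E (lift ord_max i) = G i.
Proof. by rewrite /extend liftK. Qed.

Lemma disj_extend n (G : 'I_n -> set T) E :
  disj G -> (forall i, E `&` G i = set0) -> disj (extend G E).
Proof.
move=> dG EG i j; case: (unliftP ord_max i) => [i' ->|->];
  case: (unliftP ord_max j) => [j' ->|->]; rewrite ?eqxx// ?extend_max ?extend_lift.
- by rewrite (inj_eq lift_inj); exact: dG.
- by rewrite setIC.
- by rewrite EG.
Qed.

Lemma measurable_union n (G : 'I_n -> set T) :
  (forall i, measurable (G i)) -> measurable (\bigcup_i G i).
Proof. by move=> mG; apply: fin_bigcup_measurable. Qed.

Lemma separated_measurable M n (G : 'I_n -> set T) :
  separated M G -> measurable (\bigcup_i G i).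
Proof. by case=> _ mG _; apply: measurable_union => i; have [] := mG i. Qed.

(** Write U for the union. Removing U from E costs at most mu(U), which the extra 1 in M + 1 pays
    for: what remains has measure at least M mu(U), hence at least M mu(G_i) for each i. *)
Lemma separated_extend M n (G : 'I_n -> set T) E : (0 <= M)%R ->
  separated M G -> measurable E -> mu E < +oo ->
  (M + 1)%:E * mu (\bigcup_i G i) < mu E ->
  separated M (extend G (E `\` \bigcup_i G i)).
Proof.
move=> M0 sG mE Efin ME; have mU := separated_measurable sG.
case: sG => dG mG sG; set U := \bigcup_i G i in ME mU *.
have mEU : measurable (E `\` U) by exact: measurableD.
have EUU : mu E <= mu (E `\` U) + mu U.
  by rewrite (measureDI mu mE mU) leeD2l// measureIr.
have large : M%:E * mu U <= mu (E `\` U).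
  rewrite leNgt; apply/negP => small; have := lt_le_trans ME EUU.
  rewrite EFinD ge0_muleDl ?lee_fin// mul1e ltNge => /negP; apply.
  by rewrite leeD2r// ltW.
have pos : 0 < mu (E `\` U).
  rewrite lt0e measure_ge0 andbT; apply/eqP => EU0.
  have := lt_le_trans ME EUU; rewrite EU0 add0e ltNge => /negP; apply.
  by rewrite EFinD ge0_muleDl ?lee_fin// mul1e leeDr// mule_ge0.
have fin : mu (E `\` U) < +oo.
  by apply: (le_lt_trans _ Efin); apply: le_measure; rewrite ?inE.
have le_new i : M%:E * mu (G i) <= mu (E `\` U).
  apply: (le_trans _ large); apply: lee_wpmul2l; rewrite ?lee_fin//.
  apply: le_measure; rewrite ?inE//; first by have [] := mG i.
  exact: bigcup_sup.
split=> [|i|i j].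
- apply: disj_extend => // i; rewrite -subset0 => x [[_ Ux] Gx].
  by apply: Ux; exists i.
- case: (unliftP ord_max i) => [i' ->|->]; rewrite ?extend_max ?extend_lift//.
  by rewrite pos fin.
case: (unliftP ord_max i) => [i' ->|->];
  case: (unliftP ord_max j) => [j' ->|->]; rewrite ?eqxx// ?extend_max ?extend_lift.
- by rewrite (inj_eq lift_inj); exact: sG.
- by left.
- by right.
Qed.

Lemma le_measure_extend n (G : 'I_n -> set T) E :
  (forall i, measurable (G i)) -> measurable E ->
  mu (\bigcup_i extend G (E `\` \bigcup_i G i) i) <= mu E + mu (\bigcup_i G i).
Proof.
move=> mG mE; have mU := measurable_union mG.
apply: (le_trans _ (measureU2 mu mE mU)); apply: le_measure; rewrite ?inE.
- apply: measurable_union => i; case: (unliftP ord_max i) => [i' ->|->].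
    by rewrite extend_lift.
  by rewrite extend_max; exact: measurableD.
- exact: measurableU.
move=> x [i _]; case: (unliftP ord_max i) => [i' ->|->].
  by rewrite extend_lift => Gx; right; exists i'.
by rewrite extend_max => -[]; left.
Qed.

Lemma separated0 M (G : 'I_0 -> set T) : separated M G.
Proof. by split; [case|case|case]. Qed.

(** The new set E is chosen first, below b/2; the induction hypothesis then gives earlier sets whose
    union is small compared with E. The arbitrary bound b is what makes this induction possible. *)
Lemma separated_small (M : R) n : (0 <= M)%R ->
  (forall a : R, (0 < a)%R -> exists E, measurable E /\ 0 < mu E < a%:E) ->
  forall b : R, (0 < b)%R -> exists G : 'I_n -> set T,
    separated M G /\ mu (\bigcup_i G i) < b%:E.
Proof.
move=> M0 small; elim: n => [|n IH] b b0.
  exists (fun=> set0); split; first exact: separated0.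
  by rewrite bigcup0// measure0 lte_fin.
have [E [mE /andP[E0 Eb]]] : exists E, measurable E /\ 0 < mu E < (b / 2)%:E.
  by apply: small; rewrite divr_gt0.
have Efin : mu E < +oo by rewrite (lt_trans Eb) ?ltry.
have eE : mu E = (fine (mu E))%:E by rewrite fineK ?ge0_fin_numE.
set e := fine (mu E) in eE; rewrite eE !lte_fin in E0 Eb.
have M1 : (0 < M + 1)%R by rewrite ltr_wpDl.
have [G [sG Ge]] := IH _ (divr_gt0 E0 M1).
exists (extend G (E `\` \bigcup_i G i)); split.
  apply: separated_extend => //; rewrite eE.
  by rewrite muleC -lte_pdivlMr// -EFinM.
have [_ mG _] := sG; apply: le_lt_trans (le_measure_extend _ mE) _.
  by move=> i; have [] := mG i.
rewrite eE [b in ltRHS]splitr EFinD; apply: lteD; rewrite ?lte_fin//.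
apply: lt_trans Ge _; rewrite lte_fin; apply: (le_lt_trans _ Eb).
by rewrite ler_pdivrMr//; apply: ler_peMr; rewrite ?lerDr// ltW.
Qed.

(** Here the order is reversed: the family comes first, and E is then taken large compared with its
    union. *)
Lemma separated_large (M : R) n : (0 <= M)%R ->
  (forall b : R, exists E, measurable E /\ b%:E < mu E < +oo) ->
  exists G : 'I_n -> set T, separated M G /\ mu (\bigcup_i G i) < +oo.
Proof.
move=> M0 large; elim: n => [|n [G [sG Gfin]]].
  exists (fun=> set0); split; first exact: separated0.
  by rewrite bigcup0// measure0 ltry.
have [E [mE /andP[bE Efin]]] := large ((M + 1) * fine (mu (\bigcup_i G i)))%R.
exists (extend G (E `\` \bigcup_i G i)); split.
  apply: separated_extend => //.
  by rewrite EFinM fineK ?ge0_fin_numE in bE.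
have [_ mG _] := sG; apply: le_lt_trans (le_measure_extend _ mE) _.
  by move=> i; have [] := mG i.
by rewrite lte_add_pinfty.
Qed.

(** The pivot of the equivalences: it follows from (i) and from (ii), and implies (iii). Sets of
    infinite measure are left unconstrained. *)
Definition measures_bounded := exists a b : R, (0 < a)%R /\
  forall E, measurable E -> 0 < mu E < +oo -> a%:E <= mu E <= b%:E.

(** Either finite positive measures come arbitrarily close to 0, or they are arbitrarily large; each
    case has its own construction. *)
Lemma unbounded_separated (M : R) n : (0 <= M)%R -> ~ measures_bounded ->
  exists G : 'I_n -> set T, separated M G.
Proof.
move=> M0 unb.
have [small|] := pselect (forall a : R, (0 < a)%R ->
    exists E, measurable E /\ 0 < mu E < a%:E).
  by have [G []] := separated_small n M0 small ltr01; exists G.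
move=> /existsNP[a] /not_implyP[a0 small].
have [large|] := pselect (forall b : R, exists E, measurable E /\ b%:E < mu E < +oo).
  by have [G []] := separated_large n M0 large; exists G.
move=> /existsNP[b large]; case: unb; exists a, b; split=> // E mE /andP[E0 Efin].
apply/andP; split; rewrite leNgt; apply/negP => h.
  by apply: small; exists E; rewrite E0.
by apply: large; exists E; rewrite h.
Qed.

End separated_families.

(** * Lower bound for the approximation error *)

Section lower_bound.
Context {d : measure_display} {T : measurableType d} {R : realType}.
Variable mu : {measure set T -> \bar R}.

Lemma separated_coefficients (p K : R) n (G : 'I_n -> set T) :
  0 < p -> 0 <= K -> separated mu (K `^ p) G ->
  exists c : 'I_n -> R,
    [/\ forall i, 0 < c i,
        forall i, ((c i `^ p)%:E * mu (G i) = (n%:R^-1)%:E)%E &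
        forall i j, i != j -> K * c i <= c j \/ K * c j <= c i].
Proof.
move=> p0 K0 [_ mG sG].
pose m i := fine (mu (G i)).
have mE i : mu (G i) = (m i)%:E.
  by have [_ /andP[? ?]] := mG i; rewrite fineK// ge0_fin_numE.
have m0 i : 0 < m i by have [_ /andP[+ _]] := mG i; rewrite mE.
have n0 (i : 'I_n) : 0 < n%:R :> R by rewrite ltr0n (leq_ltn_trans _ (ltn_ord i)).
(* This normalization puts mass 1/n of the p-th power on each [G i]. *)
pose c i := ((n%:R * m i)^-1) `^ p^-1.
have cp i : c i `^ p = (n%:R * m i)^-1.
  by rewrite -powRrM mulVf ?gt_eqF// powRr1// invr_ge0 mulr_ge0// ltW.
have c0 i : 0 < c i by rewrite powR_gt0// invr_gt0 mulr_gt0// (n0 i).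
(* A larger measure gets a smaller coefficient, so a ratio K^p between measures becomes a ratio K
   between coefficients, in reverse order. *)
have le_c i j : (K `^ p * m i <= m j) -> K * c j <= c i.
  move=> mij; rewrite leNgt; apply/negP => cij.
  have cn j' : c j' \in Num.nneg by rewrite nnegrE ltW.
  have Kn : K * c j \in Num.nneg by rewrite nnegrE mulr_ge0// ltW.
  have := gt0_ltr_powR p0 (cn i) Kn cij.
  rewrite powRM ?(ltW (c0 _))// !cp ltNge => /negP; apply.
  rewrite !invfM mulrCA ler_pM2l ?invr_gt0 ?(n0 i)//.
  by rewrite ler_pdivrMr// mulrC ler_pdivlMr.
exists c; split=> // [i|i j ij].
  rewrite cp mE -EFinM invfM -mulrA mulVf ?mulr1// gt_eqF//.
have := sG _ _ ij; rewrite !mE -!EFinM !lee_fin.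
by case=> /le_c; [right|left].
Qed.

(** The inequality between k and n says that q^p (n - k) / n > eps^p: at least n - k of the sets
    each contribute q^p / n to the p-th power of the error. *)
Lemma separated_not_approx (p q eps K : R) n k (G : 'I_n -> set T) :
  0 < p -> 0 <= eps -> 0 < q < 1 -> 0 <= K -> 1 + q <= K * (1 - q) ->
  k%:R * q `^ p < n%:R * (q `^ p - eps `^ p) ->
  separated mu (K `^ p) G -> ~ approx_k mu p eps (unit_ball mu p) k.
Proof.
move=> p0 eps0 /andP[q0 q1] K0 Kq kn sG [_ approx].
have [c [c0 cG cK]] := separated_coefficients p0 K0 sG.
have [dG mG _] := sG; have pN0 : p != 0 by rewrite gt_eqF.
have mG1 i : measurable (G i) by have [] := mG i.
have n0 : (0 < n)%N.
  rewrite lt0n; apply/eqP => n0; move: kn; rewrite n0 mul0r ltNge => /negP; apply.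
  by rewrite mulr_ge0// powR_ge0.
have nR0 : n%:R != 0 :> R by rewrite pnatr_eq0 -lt0n.
have ball : unit_ball mu p (step c G).
  split.
    apply: inLp_step => // i; right; by have [_ /andP[]] := mG i.
  apply/pnorm_le => //; rewrite Lp_int_step// powR1.
  under eq_bigr do rewrite gtr0_norm// cG.
  rewrite sumEFin sumr_const card_ord -[X in X%:E]mulr_natl.
  by rewrite mulfV.
have [h [[hLp [l [A [a [lk [mA [dA [cA hE]]]]]]]]]] := approx _ ball.
move=> /(pnorm_le _ _ p0 eps0); apply/negP; rewrite -ltNge.
pose bad : pred 'I_n := [pred i | [exists j, `|c i - a j| < q * c i]].
have card_bad : (#|bad| <= k)%N.
  exact: leq_trans (card_approximated a q1 Kq c0 cK) lk.
(* Off [bad], all values of [h] are at distance at least q c_i from c_i, which bounds |f - h|^p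
   below by (q c_i)^p on [G i]; elsewhere the bound 0 suffices. *)
pose b i := if bad i then 0 else q `^ p * c i `^ p.
have b0 i : 0 <= b i by rewrite /b; case: ifP => // _; rewrite mulr_ge0 ?powR_ge0.
have le_b x : step b G x <= `|step c G x - h x| `^ p.
  have [[i Gi]|Gx] := pselect (exists i, G i x); last first.
    by rewrite step_out ?powR_ge0// => i Gi; apply: Gx; exists i.
  rewrite !(step_in _ dG Gi) /b; case: ifPn => [_|]; first exact: powR_ge0.
  have [j _ Aj] : (\bigcup_(i in [set: 'I_l]) A i) x by rewrite cA.
  have -> : h x = a j by rewrite hE -/(step a A x) (step_in _ dA Aj).
  move=> /existsPn /(_ j); rewrite -leNgt => near.
  rewrite -powRM ?(ltW q0) ?(ltW (c0 i))//.
  by apply: ge0_ler_powR; rewrite ?nnegrE ?mulr_ge0// ?(ltW p0) ?(ltW q0) ?(ltW (c0 i)).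
apply: (@lt_le_trans _ _ (\int[mu]_x (step b G x)%:E)%E); last first.
  apply: ge0_le_integral => //.
  - by move=> x _; rewrite lee_fin step_ge0.
  - by apply/measurable_EFinP; exact: measurable_step.
  - apply: measurable_normr_powR; apply: measurable_funB; last by case: hLp.
    exact: measurable_step.
  - by move=> x _; rewrite lee_fin.
rewrite integral_step//.
have bG i : ((b i)%:E * mu (G i) = (if i \in predC bad then q `^ p / n%:R else 0)%:E)%E.
  by rewrite /b inE; case: (bad i); rewrite ?mul0e// EFinM -muleA cG -EFinM.
under eq_bigr do rewrite bG.
rewrite sumEFin lte_fin -big_mkcond/= sumr_const.
have := cardC bad; rewrite card_ord => nE.
have goodn : n%:R - k%:R <= #|predC bad|%:R :> R.
  by rewrite lerBlDr -natrD ler_nat -[X in (X <= _)%N]nE addnC leq_add2l.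
rewrite -[ltRHS]mulr_natr mulrAC ltr_pdivlMr ?ltr0n//.
apply: (lt_le_trans _ (ler_wpM2l (powR_ge0 q p) goodn)).
by move: kn; rewrite !mulrBr ltrBrDl [k%:R * _]mulrC ![n%:R * _]mulrC ltrBrDr addrC.
Qed.

End lower_bound.

(** * Consequences of unbounded measures *)

Section unbounded_measures.
Context {d : measure_display} {T : measurableType d} {R : realType}.
Variable mu : {measure set T -> \bar R}.

Lemma unbounded_N_infinite (p eps : R) : 0 < p -> ~ measures_bounded mu ->
  0 < eps < 1 -> N_infinite mu p eps (unit_ball mu p).
Proof.
move=> p0 unb /andP[eps0 eps1] k.
(* Any q strictly between eps and 1 would do: q > eps makes q^p - eps^p positive, and q < 1 lets K
   solve 1 + q = K (1 - q). *)
pose q := (1 + eps) / 2; pose K := (1 + q) / (1 - q).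
have q0 : 0 < q by rewrite /q; lra.
have q1 : q < 1 by rewrite /q; lra.
have epsq : eps < q by rewrite /q; lra.
have D0 : 0 < q `^ p - eps `^ p.
  by rewrite subr_gt0 gt0_ltr_powR// nnegrE ltW.
have K0 : 0 <= K by rewrite divr_ge0//; lra.
pose n := Num.bound `|k%:R * q `^ p / (q `^ p - eps `^ p)|.
have [G sG] := unbounded_separated n (powR_ge0 K p) unb.
apply: (separated_not_approx p0 (ltW eps0) _ K0 _ _ sG (q := q)).
- by rewrite q0.
- by rewrite divfK// gt_eqF// subr_gt0.
by rewrite -ltr_pdivrMr// ltr_bound_normr.
Qed.

(** The rows of the matrix expressing the indicators of the [G j] in the generators are independent:
    if v C = 0, then the combination of indicators with coefficients v vanishes almost everywhere,
    yet it equals v_j on [G j], which is not null. *)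
Lemma finite_dim_disj_card (p : R) n (g : 'I_n -> T -> R) m (G : 'I_m -> set T) :
  0 < p ->
  (forall f, inLp mu p f ->
     exists c : 'I_n -> R, f = (fun x => \sum_(i < n) c i * g i x) %[ae mu]) ->
  disj G -> (forall i, measurable (G i) /\ (0 < mu (G i) < +oo)%E) -> (m <= n)%N.
Proof.
move=> p0 gen dG mG.
pose e j := step (fun i : 'I_m => (i == j)%:R : R) G.
have /choice[c cE] j : exists c : 'I_n -> R,
    e j = (fun x => \sum_(i < n) c i * g i x) %[ae mu].
  apply: gen; apply: inLp_step; rewrite ?gt_eqF//.
    by move=> i; have [] := mG i.
  by move=> i; right; have [_ /andP[]] := mG i.
pose C := \matrix_(j < m, i < n) c j i.
suff /eqP <- : row_free C by exact: rank_leq_col.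
rewrite -kermx_eq0; apply/negPn/negP => /rowV0Pn[v /sub_kermxP vC].
apply/negP/negPn/eqP/rowP => j; rewrite mxE; apply: contrapT => vj.
have [mGj /andP[Gj0 _]] := mG j.
have /(measure_negligible mGj) Gj : mu.-negligible (G j).
  rewrite -[G j]setCK; change (\forall x \ae mu, ~ G j x).
  (* Finitely many almost everywhere identities hold together off one null set. *)
  have ae_c := filter_forall (ae_filter_ringOfSetsType mu) cE.
  apply: filterS ae_c => x cx Gx; apply: vj.
  have <- : \sum_i v 0 i * e i x = v 0 j.
    rewrite (bigD1 j)//= big1 => [|i ij]; rewrite /e (step_in _ dG Gx).
      by rewrite eqxx mulr1 addr0.
    by rewrite eq_sym (negbTE ij) mulr0.
  under eq_bigr => i _ do rewrite (cx i I) big_distrr/=.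
  rewrite exchange_big/= big1// => i _.
  have := congr1 (fun M : 'rV_n => M 0 i) vC; rewrite !mxE => vCi.
  under eq_bigr do rewrite mulrA.
  rewrite -big_distrl/= (_ : \sum_(i0 < m) _ = 0) ?mul0r// -[RHS]vCi.
  by apply: eq_bigr => k _; rewrite mxE.
by rewrite Gj ltxx in Gj0.
Qed.

End unbounded_measures.

(** * Atoms, and atomicity from bounded measures *)

Section atoms.
Context {d : measure_display} {T : measurableType d} {R : realType}.
Variable mu : {measure set T -> \bar R}.
Local Open Scope ereal_scope.
Implicit Types (A B E : set T).

(** Since B is not null, the atom property forces mu(A) <= mu(B); finiteness then allows subtracting
    mu(B). *)
Lemma atom_setD0 A B : is_atom mu A -> mu A < +oo -> measurable B ->
  B `<=` A -> mu B <> 0 -> mu (A `\` B) = 0.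
Proof.
move=> [mA [_ atomA]] Afin mB BA B0.
have AB : mu A <= mu B.
  by rewrite leNgt; apply/negP => /(atomA _ mB BA).
have Bfin : mu B \is a fin_num.
  rewrite ge0_fin_numE//; apply: (le_lt_trans _ Afin).
  by apply: le_measure; rewrite ?inE.
have := AB; rewrite (measureDI mu mA mB) (setIidr BA).
rewrite -[leRHS]add0e leeD2rE// => AB0; apply/eqP.
by rewrite -measure_le0.
Qed.

Lemma sub_atom A B : is_atom mu A -> measurable B -> B `<=` A -> mu B <> 0 ->
  is_atom mu B.
Proof.
move=> [mA [_ atomA]] mB BA B0; split=> //; split.
  by rewrite lt0e measure_ge0 andbT; exact/eqP.
move=> E mE EB EltB; apply: atomA => //; first exact: subset_trans BA.
by apply: (lt_le_trans EltB); apply: le_measure; rewrite ?inE.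
Qed.

(** Without an atom inside A, every subset of positive measure can be split strictly, and each split
    of a set of finite measure discards a piece of measure at least a. This cannot go on more than
    b/a times. *)
Lemma bounded_atomic : measures_bounded mu -> atomic mu.
Proof.
move=> [a [b [a0 ab]]] A mA A0; apply: contrapT => noatom.
have split_set B : measurable B -> B `<=` A -> 0 < mu B ->
    exists E, [/\ measurable E, E `<=` B, 0 < mu E & mu E < mu B].
  move=> mB BA B0; apply: contrapT => noE; apply: noatom.
  exists B; split=> //; split=> //; split=> // E mE EB EltB.
  apply/eqP; rewrite -measure_le0 leNgt; apply/negP => E0.
  by apply: noE; exists E.
have descent n : exists E, [/\ measurable E, E `<=` A, 0 < mu E < +oo &
    mu E <= (b - n%:R * a)%:E].
  elim: n => [|n [E [mE EA /andP[E0 Efin] Eb]]].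
    (* A may have infinite measure; a first strict split reaches a finite one, to which the bound b
       applies. *)
    have [E [mE EA E0 EltA]] := split_set A mA (@subset_refl _ A) A0.
    have Efin := lt_le_trans EltA (leey _).
    exists E; split; rewrite ?E0// mul0r subr0.
    by have /andP[] := ab E mE (introT andP (conj E0 Efin)).
  have [F [mF FE F0 FltE]] := split_set E mE EA E0.
  have Ffin := lt_trans FltE Efin.
  have Ffn : mu F \is a fin_num by rewrite ge0_fin_numE.
  have mEF : measurable (E `\` F) by exact: measurableD.
  have EE : mu E = mu (E `\` F) + mu F by rewrite (measureDI mu mE mF) (setIidr FE).
  have EF0 : 0 < mu (E `\` F).
    rewrite lt0e measure_ge0 andbT; apply/eqP => EF0.
    by rewrite EE EF0 add0e ltxx in FltE.
  have EFfin : mu (E `\` F) < +oo.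
    by apply: (le_lt_trans _ Efin); apply: le_measure; rewrite ?inE.
  have /andP[aEF _] := ab _ mEF (introT andP (conj EF0 EFfin)).
  exists F; split=> //; [exact: subset_trans EA|by rewrite F0 Ffin|].
  have : a%:E + mu F <= (b - n%:R * a)%:E.
    by apply: (le_trans _ Eb); rewrite EE leeD2r.
  rewrite -(fineK Ffn) -EFinD !lee_fin -natr1 mulrDl mul1r; lra.
have [E [mE _ E0 Eb]] := descent (Num.bound `|b / a|%R).
have /andP[aE _] := ab E mE E0; have := le_trans aE Eb; rewrite lee_fin.
apply/negP; rewrite -ltNge.
by have := ltr_bound_normr (b / a)%R; rewrite ltr_pdivrMr// => ba; lra.
Qed.

End atoms.

(** * Finite unions of null sets and maximal families of disjoint atoms *)

Lemma negligible_fin_bigcup {d : measure_display} {T : measurableType d}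
    {R : realType} (mu : {measure set T -> \bar R}) (I : finType) (F : I -> set T) :
  (forall i, mu.-negligible (F i)) -> mu.-negligible (\bigcup_i F i).
Proof.
move=> nF; have ae_F i : \forall x \ae mu, ~ F i x.
  by apply: negligibleS (nF i) => x /contrapT.
apply: negligibleS (filter_forall (ae_filter_ringOfSetsType mu) ae_F).
by move=> x [i _ Fx] /(_ i).
Qed.

Section atom_families.
Context {d : measure_display} {T : measurableType d} {R : realType}.
Variable mu : {measure set T -> \bar R}.
Local Open Scope ereal_scope.
Implicit Types (B E : set T).

Definition atom_family n (A : 'I_n -> set T) :=
  disj A /\ forall i, is_atom mu (A i) /\ mu (A i) < +oo.

(** Maximality is in cardinality, not inclusion: no family whatever has n + 1 members. *)
Definition maximal_atom_family n (A : 'I_n -> set T) :=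
  atom_family A /\ forall A' : 'I_n.+1 -> set T, ~ atom_family A'.

Lemma atom_family_measurable n (A : 'I_n -> set T) : atom_family A ->
  (forall i, measurable (A i)) /\ measurable (\bigcup_i A i).
Proof.
move=> [_ atA]; have mA i : measurable (A i) by have [[]] := atA i.
by split=> //; exact: measurable_union.
Qed.

Lemma exists_maximal_atom_family N :
  (forall n (A : 'I_n -> set T), atom_family A -> (n <= N)%N) ->
  exists n (A : 'I_n -> set T), maximal_atom_family A.
Proof.
move=> bdd.
pose P n := `[< exists A : 'I_n -> set T, atom_family A >].
have exP : exists n, P n.
  by exists 0%N; apply/asboolP; exists (fun=> set0); split; case.
have leN n : P n -> (n <= N)%N by move=> /asboolP[A /bdd].
case: (ex_maxnP exP leN) => n /asboolP[A atA] maxn.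
exists n, A; split=> // A' atA'.
have /maxn : P n.+1 by apply/asboolP; exists A'.
by rewrite ltnn.
Qed.

(** Otherwise the part of B outside the union would itself be an atom of finite measure, and could
    be added to the family. *)
Lemma maximal_atom_family_setD0 n (A : 'I_n -> set T) B :
  maximal_atom_family A -> is_atom mu B -> mu B < +oo ->
  mu (B `\` \bigcup_i A i) = 0.
Proof.
move=> [famA maxA] atB Bfin; have [dA atA] := famA.
have [mA mU] := atom_family_measurable famA; have [mB _] := atB.
apply: contrapT => BU0; set U := \bigcup_i A i in mU BU0.
have mBU : measurable (B `\` U) by exact: measurableD.
apply: (maxA (extend A (B `\` U))); split.
  apply: disj_extend => // i; rewrite -subset0 => x [[_ Ux] Ax].
  by apply: Ux; exists i.
move=> i; case: (unliftP ord_max i) => [i' ->|->]; rewrite ?extend_max ?extend_lift//.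
split; first exact: (sub_atom atB).
by apply: (le_lt_trans _ Bfin); apply: le_measure; rewrite ?inE.
Qed.

(** An atom inside E would be disjoint from the family, hence null by maximality. *)
Lemma atomic_maximal_null n (A : 'I_n -> set T) E : atomic mu ->
  maximal_atom_family A -> measurable E -> mu E < +oo ->
  E `&` \bigcup_i A i = set0 -> mu E = 0.
Proof.
move=> atomic_mu maxA mE Efin EA; apply/eqP; rewrite -measure_le0 leNgt.
apply/negP => /(atomic_mu _ mE)[B [BE atB]]; have [mB [B0 _]] := atB.
have Bfin : mu B < +oo.
  by apply: (le_lt_trans _ Efin); apply: le_measure; rewrite ?inE.
have := maximal_atom_family_setD0 maxA atB Bfin.
rewrite setDidl => [B00|]; first by rewrite B00 ltxx in B0.
by rewrite -subset0 -EA; exact: setSI.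
Qed.

Lemma bounded_atom_family_card : measures_bounded mu ->
  exists N, forall n (A : 'I_n -> set T), atom_family A -> (n <= N)%N.
Proof.
(* The empty family is set aside: its union is null, so the bound b says nothing about it. Otherwise
   the union has finite positive measure, at least a times the number of atoms and at most b. *)
move=> [a [b [a0 ab]]]; exists (Num.bound `|b / a|%R) => -[//|n] A famA.
have [dA atA] := famA; have [mA _] := atom_family_measurable famA.
have ge_a i : a%:E <= mu (A i).
  have [[_ [A0 _]] Afin] := atA i.
  by have /andP[] := ab _ (mA i) (introT andP (conj A0 Afin)).
have sumE : mu (\big[setU/set0]_(i < n.+1) A i) = \sum_(i < n.+1) mu (A i).
  apply: measure_bigsetU_ord => //; apply/trivIsetP => i j _ _; exact: dA.
have sum_ge : (n.+1%:R * a)%:E <= \sum_(i < n.+1) mu (A i).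
  apply: (@le_trans _ _ (\sum_(i < n.+1) a%:E)); last exact: lee_sum.
  by rewrite sumEFin sumr_const card_ord mulr_natl.
have sum_fin : \sum_(i < n.+1) mu (A i) < +oo.
  by apply: lte_sum_pinfty => i _; have [] := atA i.
have /andP[_ le_b] : a%:E <= \sum_(i < n.+1) mu (A i) <= b%:E.
  rewrite -sumE; apply: ab; first exact: bigsetU_measurable.
  rewrite sumE sum_fin andbT; apply: lt_le_trans sum_ge.
  by rewrite lte_fin mulr_gt0// ltr0n.
have := le_trans sum_ge le_b; rewrite lee_fin -ler_pdivlMr// => nb.
by rewrite ltnW// -(ltr_nat R) (le_lt_trans nb)// ltr_bound_normr.
Qed.

(** A maximal disjoint family serves as the list. An atom B of finite measure is null outside its
    union, so it meets some [A i] in a set of positive measure, which fills both atoms up to null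
    sets. *)
Lemma bounded_finite_atoms :
  measures_bounded mu -> finite_atoms_finite_measure mu.
Proof.
move=> bdd; have [N leN] := bounded_atom_family_card bdd.
have [n [A maxA]] := exists_maximal_atom_family leN.
have [famA _] := maxA; have [_ atA] := famA.
have [mA mU] := atom_family_measurable famA.
exists [seq A i | i <- enum 'I_n]; split; first by move=> _ /mapP[i _ ->].
move=> B atB; have [mB [B0 _]] := atB.
have [Bfin|] := ltP (mu B) +oo; last by rewrite leye_eq => /eqP; left.
right; have BU := maximal_atom_family_setD0 maxA atB Bfin.
have [i BAi] : exists i, mu (B `&` A i) <> 0.
  apply: contrapT => /forallNP null.
  suff : mu.-negligible B.
    by move=> /(measure_negligible mB) B00; rewrite B00 ltxx in B0.
  have nullU : mu.-negligible (\bigcup_(i in [set: 'I_n]) (B `&` A i)).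
    apply: negligible_fin_bigcup => i; apply/negligibleP; first exact: measurableI.
    exact: contrapT (null i).
  have nullD : mu.-negligible (B `\` \bigcup_i A i).
    by apply/negligibleP => //; exact: measurableD.
  apply: negligibleS (negligibleU nullD nullU).
  move=> x Bx; have [[i _ Ai]|] := pselect ((\bigcup_i A i) x); last by left.
  by right; exists i.
have mBA : measurable (B `&` A i) by exact: measurableI.
have [atAi Aifin] := atA i.
exists (A i); first by apply: map_f; rewrite mem_enum.
rewrite /symdiff; apply: null_set_setU; try exact: measurableD.
  apply: subset_measure0 (atom_setD0 atAi Aifin mBA _ BAi); try exact: measurableD.
    by move=> x [Ax Bx]; split=> // -[].
  exact: subIsetr.
apply: subset_measure0 (atom_setD0 atB Bfin mBA _ BAi); try exact: measurableD.
  by move=> x [Bx Ax]; split=> // -[].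
exact: subIsetl.
Qed.

(** Each member of the family equals some listed X up to a null set. Two disjoint members cannot
    share X, since the first lies in the union of the two null symmetric differences with X. *)
Lemma finite_atoms_atom_family_card : finite_atoms_finite_measure mu ->
  exists N, forall n (A : 'I_n -> set T), atom_family A -> (n <= N)%N.
Proof.
move=> [C [atC covC]]; exists (size C) => n A [dA atA].
have /choice[X XP] i : exists X, X \in C /\ mu (symdiff X (A i)) = 0.
  have [atAi Aifin] := atA i; have [Ai|[X XC X0]] := covC _ atAi.
    by rewrite Ai ltxx in Aifin.
  by exists X.
have idx i : (index (X i) C < size C)%N by rewrite index_mem; have [] := XP i.
suff inj : injective (fun i => Ordinal (idx i)).
  by have := leq_card _ inj; rewrite !card_ord.
move=> i j /(congr1 val)/= ij; apply/eqP/negP => /negP /dA Aij.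
have [XC Xi0] := XP i; have [XC' Xj0] := XP j.
have XE : X i = X j.
  by rewrite -(nth_index set0 XC) ij nth_index.
have [[mAi [Ai0 _]] _] := atA i; have [[mAj _] _] := atA j.
have [[mX _] _] := atC _ XC.
have msym E : measurable E -> measurable (symdiff (X i) E).
  by move=> mE; apply: measurableU; exact: measurableD.
have AiE : A i `<=` symdiff (X i) (A i) `|` symdiff (X i) (A j).
  move=> x Ax; have [Xx|Xx] := pselect (X i x); last by left; right.
  right; left; split=> // Ajx.
  by have : (A i `&` A j) x by []; rewrite Aij.
suff : mu (A i) = 0 by move=> A0; rewrite A0 ltxx in Ai0.
apply: (subset_measure0 _ _ AiE) => //; first by apply: measurableU; exact: msym.
apply: null_set_setU => //; try exact: msym.
by rewrite XE.
Qed.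

End atom_families.

(** * Functions in L^p over an atomic measure *)

Section atomic_representation.
Context {d : measure_display} {T : measurableType d} {R : realType}.
Variable mu : {measure set T -> \bar R}.
Implicit Types (f : T -> R) (p : R).

(** Chebyshev's inequality: |f|^p dominates t^p times the indicator of E. *)
Lemma inLp_measure_lty p f t E : 0 < p -> 0 < t -> inLp mu p f -> measurable E ->
  (forall x, E x -> t <= `|f x|) -> (mu E < +oo)%E.
Proof.
move=> p0 t0 [mf] /(Lp_int_lty _ _ (lt0r_neq0 p0)) f_fin mE tE.
pose s := step (fun _ : 'I_1 => t `^ p) (fun=> E).
have dE : disj (fun _ : 'I_1 => E) by move=> i j; rewrite !ord1.
have : (\int[mu]_x (s x)%:E < +oo)%E.
  apply: (le_lt_trans _ f_fin); apply: ge0_le_integral => //.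
  - by move=> x _; rewrite lee_fin step_ge0// => _; exact: powR_ge0.
  - by apply/measurable_EFinP; exact: measurable_step.
  - exact: measurable_normr_powR.
  - move=> x _; rewrite lee_fin; have [Ex|Ex] := pselect (E x).
      rewrite /s (step_in _ (i := ord0) dE)//.
      by apply: ge0_ler_powR; rewrite ?nnegrE ?tE// ltW.
    by rewrite /s step_out ?powR_ge0.
rewrite integral_step// => [|i]; last exact: powR_ge0.
rewrite big_ord1; case: (mu E) => [r| |]; rewrite ?ltry ?ltNyr//.
by rewrite gt0_muley ?lte_fin ?powR_gt0.
Qed.

(** For every t, one of {f < t} and {f >= t} is null in A. The constant is the supremum of the t for
    which {f < t} is null, that is, the essential infimum of f on A. *)
Lemma atom_ae_constant f A : is_atom mu A -> (mu A < +oo)%E ->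
  measurable_fun setT f ->
  exists c, mu.-negligible (A `&` [set x | f x != c]).
Proof.
move=> atA Afin mf; have [mA [A0 _]] := atA.
have mlt t : measurable (A `&` [set x | f x < t]).
  apply: measurableI => //; rewrite -[X in measurable X]setTI.
  exact: (mf measurableT _ (measurable_itv `]-oo, t[)).
have mge t : measurable (A `&` [set x | t <= f x]).
  apply: measurableI => //; rewrite -[X in measurable X]setTI.
  have := mf measurableT _ (measurable_itv `[t, +oo[).
  by congr measurable; apply/seteqP; split=> x /=; rewrite in_itv/= andbT.
have notnull : ~ mu.-negligible A.
  by move=> /(measure_negligible mA) A00; rewrite A00 ltxx in A0.
pose S := [set t | mu.-negligible (A `&` [set x | f x < t])].
have notS t : ~ S t -> mu.-negligible (A `&` [set x | t <= f x]).
  move=> St; apply/negligibleP => //.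
  have lt0 : mu (A `&` [set x | f x < t]) <> 0%E.
    by move=> lt0; apply: St; apply/negligibleP.
  have sub : A `&` [set x | f x < t] `<=` A by move=> x [].
  have mD : measurable (A `\` (A `&` [set x | f x < t])) by exact: measurableD.
  apply: (subset_measure0 _ mD _ (atom_setD0 atA Afin (mlt t) sub lt0)) => //.
  by move=> x [Ax tx]; split=> // -[_] /=; rewrite ltNge tx.
(* If no t qualified, all the sets {f >= -n} would be null in A; they cover A, as do the sets {f <
   n} used for the upper bound. *)
have S_nonempty : S !=set0.
  apply: contrapT => /set0P/negP/negPn/eqP S0; apply: notnull.
  have null n : mu.-negligible (A `&` [set x | - (n%:R) <= f x]).
    by apply: notS; rewrite S0.
  apply: negligibleS (negligible_bigcup null) => x Ax.
  by exists (Num.bound `|f x|) => //; split=> //=; rewrite lerNl -normrN ltW// ltr_bound_normr.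
have S_ubound : has_ubound S.
  apply: contrapT => nub; apply: notnull.
  have Sn (n : nat) : S n%:R.
    apply: contrapT => nSn; apply: nub; exists n%:R => t St.
    rewrite leNgt; apply/negP => nt; apply: nSn.
    by apply: negligibleS St => x [Ax /= xn]; split=> //=; exact: lt_trans nt.
  apply: negligibleS (negligible_bigcup Sn) => x Ax.
  by exists (Num.bound `|f x|) => //; split=> //=; exact: ltr_bound_normr.
have supS : has_sup S by [].
pose c := sup S; exists c.
have below n : mu.-negligible (A `&` [set x | f x < c - n.+1%:R^-1]).
  have n0 : 0 < n.+1%:R^-1 :> R by rewrite invr_gt0.
  have [t St ct] := sup_adherent n0 supS.
  by apply: negligibleS St => x [Ax /= xc]; split=> //=; exact: lt_trans ct.
have above n : mu.-negligible (A `&` [set x | c + n.+1%:R^-1 <= f x]).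
  apply: notS => /(ub_le_sup S_ubound); apply/negP; rewrite -ltNge.
  by rewrite ltrDl invr_gt0.
apply: negligibleS (negligibleU (negligible_bigcup below) (negligible_bigcup above)).
move=> x [Ax /=]; rewrite neq_lt => /orP[fc|fc].
  have [k kc] := ltr_add_invr fc.
  by left; exists k => //; split=> //=; rewrite ltrBrDr.
have [k kc] := ltr_add_invr fc.
by right; exists k => //; split=> //=; exact: ltW.
Qed.

(** On each atom f is almost everywhere constant. Off the atoms, {|f| >= 1/(k+1)} has finite measure
    by Chebyshev, hence is null; the union over k is where f differs from 0. *)
Lemma atomic_ae_step p f n (A : 'I_n -> set T) : 0 < p -> atomic mu ->
  maximal_atom_family mu A -> inLp mu p f ->
  exists c, f = step c A %[ae mu].
Proof.
move=> p0 atomic_mu maxA fLp; have [mf _] := fLp.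
have [famA _] := maxA; have [dA atA] := famA.
have [mA mU] := atom_family_measurable famA.
have /choice[c cA] i : exists c, mu.-negligible (A i `&` [set x | f x != c]).
  by have [? ?] := atA i; exact: atom_ae_constant.
exists c; pose E k := [set x | k.+1%:R^-1 <= `|f x|] `\` \bigcup_i A i.
have nE k : mu.-negligible (E k).
  have mE : measurable (E k).
    apply: measurableD => //; rewrite -[X in measurable X]setTI.
    have mnf : measurable_fun setT (fun x => `|f x|) by exact: measurableT_comp.
    have := mnf measurableT _ (measurable_itv `[k.+1%:R^-1, +oo[).
    by congr measurable; apply/seteqP; split=> x /=; rewrite in_itv/= andbT.
  apply/negligibleP => //; apply: (atomic_maximal_null atomic_mu maxA) => //.
    by apply: (inLp_measure_lty p0 _ fLp mE (t := k.+1%:R^-1)) => // x [].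
  by rewrite -subset0 => x [[_ Ux]].
have nU := negligibleU (negligible_fin_bigcup cA) (negligible_bigcup nE).
apply: negligibleS nU => x fx.
have {}fx : f x != step c A x by apply/eqP => fxE; apply: fx.
have [[i _ Ax]|Ax] := pselect ((\bigcup_i A i) x).
  by left; exists i => //; split=> //=; rewrite -(step_in c dA Ax).
right; rewrite step_out in fx; last by move=> i Ai; apply: Ax; exists i.
have [k kf] : exists k, 0 + k.+1%:R^-1 < `|f x| by apply: ltr_add_invr; rewrite normr_gt0.
by exists k => //; split=> //=; rewrite -[leLHS]add0r ltW.
Qed.

(** Each f equals almost everywhere a function with n + 1 pieces, so the error is 0 whatever eps
    is. *)
Lemma N_finite_of_atomic p eps n (A : 'I_n -> set T) : 0 < p -> 0 <= eps ->
  atomic mu -> maximal_atom_family mu A -> N_finite mu p eps (unit_ball mu p).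
Proof.
move=> p0 eps0 atomic_mu maxA; have [famA _] := maxA; have [dA atA] := famA.
have [mA mU] := atom_family_measurable famA.
exists n.+1; split=> // f [fLp _].
have [c fE] := atomic_ae_step p0 atomic_mu maxA fLp.
(* [G_pk] asks for a partition of the whole space, so the complement of the atoms is added as an
   extra piece, with value 0 because its measure may be infinite. *)
pose A' := extend A (~` \bigcup_i A i).
pose c' i := if unlift ord_max i is Some j then c j else 0.
have dA' : disj A'.
  apply: disj_extend => // i; rewrite -subset0 => x [Ux Ax].
  by apply: Ux; exists i.
have mA' i : measurable (A' i).
  case: (unliftP ord_max i) => [i' ->|->]; rewrite /A' ?extend_max ?extend_lift//.
  exact: measurableC.
have stepE x : step c A x = step c' A' x.
  have [[i _ Ax]|Ax] := pselect ((\bigcup_i A i) x).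
    rewrite (step_in _ dA Ax) (step_in (i := lift ord_max i) _ dA').
      by rewrite /c' liftK.
    by rewrite /A' extend_lift.
  rewrite step_out; last by move=> i Ai; apply: Ax; exists i.
  rewrite (step_in (i := ord_max) _ dA'); first by rewrite /c' unlift_none.
  by rewrite /A' extend_max.
exists (step c' A'); split.
  split.
    apply: inLp_step => //; first by rewrite gt_eqF.
    move=> i; case: (unliftP ord_max i) => [i' ->|->]; rewrite /c' /A'.
      by right; rewrite extend_lift; have [] := atA i'.
    by left; rewrite unlift_none.
  exists n.+1, A', c'; split=> //; split=> //; split=> //; split=> //.
  apply/seteqP; split=> // x _.
  have [[i _ Ax]|Ax] := pselect ((\bigcup_i A i) x).
    by exists (lift ord_max i) => //; rewrite /A' extend_lift.
  by exists ord_max => //; rewrite /A' extend_max.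
have [mf _] := fLp; have mh := measurable_step c' mA'.
have p1 : p%:E != 0%E by rewrite eqe gt_eqF.
rewrite (@ae_eq_pnorm _ _ _ _ _ _ (cst 0)) //; last 2 first.
- exact: measurable_funB.
- by apply: filterS fE => x /(_ I) fx _; rewrite fx stepE subrr.
by rewrite /pnorm (_ : EFin \o cst 0 = cst 0%E)// Lnorm0.
Qed.

End atomic_representation.

(** * Assembling the equivalences *)

Section equivalences.
Context {d : measure_display} {T : measurableType d} {R : realType}.
Variable mu : {measure set T -> \bar R}.
Implicit Types p : R.

Lemma Lp_finite_dim_bounded p : 0 < p -> Lp_finite_dim mu p -> measures_bounded mu.
Proof.
move=> p0 [n [g [_ gen]]]; apply: contrapT => unb.
(* Ratio 0 makes the separation condition trivial: only n + 1 disjoint sets of finite positive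
   measure are wanted. *)
have [G [dG mG _]] := unbounded_separated n.+1 (lexx 0) unb.
by have := finite_dim_disj_card p0 gen dG mG; rewrite ltnn.
Qed.

Lemma UA_bounded p : 0 < p -> UA mu p (unit_ball mu p) -> measures_bounded mu.
Proof.
move=> p0 ua; apply: contrapT => unb.
have half : 0 < (2^-1 : R) < 1 by lra.
have /andP[half0 _] := half; have [k] := ua _ half0.
exact: unbounded_N_infinite.
Qed.

Lemma finite_atoms_exists_maximal_family : finite_atoms_finite_measure mu ->
  exists n (A : 'I_n -> set T), maximal_atom_family mu A.
Proof.
move=> /finite_atoms_atom_family_card[N leN].
exact: exists_maximal_atom_family leN.
Qed.

Lemma atomic_UA p : 0 < p -> atomic mu -> finite_atoms_finite_measure mu ->
  UA mu p (unit_ball mu p).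
Proof.
move=> p0 atomic_mu /finite_atoms_exists_maximal_family[n [A maxA]] eps eps0.
exact: N_finite_of_atomic (ltW eps0) atomic_mu maxA.
Qed.

Lemma atomic_Lp_finite_dim p : 0 < p -> atomic mu ->
  finite_atoms_finite_measure mu -> Lp_finite_dim mu p.
Proof.
move=> p0 atomic_mu /finite_atoms_exists_maximal_family[n [A maxA]].
exists n, (fun i => \1_(A i)); split; last first.
  by move=> f; exact: atomic_ae_step p0 atomic_mu maxA.
have [famA _] := maxA; have [_ atA] := famA.
have [mA _] := atom_family_measurable famA => i.
have -> : \1_(A i) = step (fun=> 1) (fun _ : 'I_1 => A i) :> (T -> R).
  by apply/funext => x; rewrite /step big_ord1 mul1r.
have dA : disj (fun _ : 'I_1 => A i) by move=> j k; rewrite !ord1.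
by apply: inLp_step; rewrite ?gt_eqF// => _; right; have [] := atA i.
Qed.

End equivalences.

Theorem theorem4p17 (d : measure_display) (T : measurableType d) (R : realType)
    (mu : {measure set T -> \bar R}) (p : R) :
  (0 < mu setT)%E -> 1 <= p ->
  ((UA mu p (unit_ball mu p) <-> Lp_finite_dim mu p) /\
   (Lp_finite_dim mu p <-> (atomic mu /\ finite_atoms_finite_measure mu))) /\
  (~ UA mu p (unit_ball mu p) ->
     forall eps : R, 0 < eps < 1 -> N_infinite mu p eps (unit_ball mu p)).
Proof.
move=> _ p1; have p0 : 0 < p by exact: lt_le_trans p1.
have bdd_atomic : measures_bounded mu ->
    atomic mu /\ finite_atoms_finite_measure mu.
  by move=> bdd; split; [exact: bounded_atomic|exact: bounded_finite_atoms].
split; [split; split|].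
- by move=> /(UA_bounded p0)/bdd_atomic[]; exact: atomic_Lp_finite_dim.
- by move=> /(Lp_finite_dim_bounded p0)/bdd_atomic[]; exact: atomic_UA.
- by move=> /(Lp_finite_dim_bounded p0)/bdd_atomic.
- by move=> []; exact: atomic_Lp_finite_dim.
(* Bounded measures would give (iii), hence (i); so failure of (i) makes the measures unbounded,
   which settles every eps in (0,1) at once. *)
move=> nua eps; apply: unbounded_N_infinite => // /bdd_atomic[? ?].
by apply: nua; exact: atomic_UA.
Qed.
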